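(* Let $G$ be a finite simple graph without isolated vertices, with minimum degree $\delta$ and maximum degree $\Delta$, and let $a \in \mathbb{R}$. Then $$ISD_a(G) \ge \frac12\, \Delta^{-a}\, GA(G), \qquad \text{if } a>0,$$ $$ISD_a(G) \ge \frac12\, \delta^{-a}\, GA(G), \qquad \text{if } a<0.$$ In each bound, equality is attained if and only if $G$ is a regular graph.
   Context: Graphs are undirected, finite, nonempty, simple (no loops, no multiple edges), without isolated vertices, and not necessarily connected; so $1\le\delta\le\Delta<n$ where $n=|V(G)|$. $d_u$ denotes the degree of the vertex $u$, and $uv$ denotes the (unordered) edge joining $u$ and $v$; sums over $uv\in E(G)$ run once over each edge. For $a\in\mathbb{R}$ the variable inverse sum deg index is $$ISD_a(G)=\sum_{uv\in E(G)}\frac{1}{d_u^a+d_v^a}.$$ The geometric-arithmetic index is $$GA(G)=\sum_{uv\in E(G)}\frac{2\sqrt{d_ud_v}}{d_u+d_v}.$$ A graph is regular if all its vertices have the same degree. *)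

(* Defs.v *)
From mathcomp Require Import all_boot all_order all_algebra.
From mathcomp Require Import reals exp.

Set Implicit Arguments.
Unset Strict Implicit.
Unset Printing Implicit Defensive.

Import Order.TTheory GRing.Theory Num.Theory.

Local Open Scope ring_scope.

Record sgraph := SGraph {
  vertex :> finType;
  adj : rel vertex;
  adj_sym : symmetric adj;
  adj_irrefl : irreflexive adj
}.

Section Graph.
Variable G : sgraph.

Definition deg (u : G) : nat := #|[set v : G | adj u v]|.

Definition edges : {set {set G}} :=
  [set E : {set G} | [exists u, exists v, adj u v && (E == [set u; v])]].

Definition no_isolated : Prop := forall u : G, (0 < deg u)%N.

Definition regular : Prop := forall u v : G, deg u = deg v.

(* Every degree is at most #|G|, so for nonempty G the default value #|G| never
   affects the minimum. *)
Definition min_deg : nat := \big[minn/#|G|]_(u : G) deg u.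

Definition max_deg : nat := (\max_(u : G) deg u)%N.

End Graph.

(* An edge uv is the two-element set [set u; v], so the inner sums and products
   over w \in E below are d_u + d_v, d_u * d_v, and the like; see big_edge. *)
Lemma big_edge (G : sgraph) (A : Type) (idx : A) (op : Monoid.com_law idx)
    (u v : G) (F : G -> A) :
  adj u v -> \big[op/idx]_(w in [set u; v]) F w = op (F u) (F v).
Proof.
move=> uv; have neq_uv : u != v.
  by apply: contraL uv => /eqP->; rewrite adj_irrefl.
by rewrite big_setU1 ?inE //= big_set1.
Qed.

Section Indices.
Variable R : realType.

Definition ISD (G : sgraph) (a : R) : R :=
  \sum_(E in edges G) 1 / (\sum_(w in E) (deg w)%:R `^ a).

Definition GA (G : sgraph) : R :=
  \sum_(E in edges G)
    2 * Num.sqrt (\prod_(w in E) (deg w)%:R) / (\sum_(w in E) (deg w)%:R).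

End Indices.

(* Main.v *)
Require Import Defs.
From mathcomp Require Import all_boot all_order all_algebra.
From mathcomp Require Import reals exp.
From mathcomp Require Import ring.

Import Order.TTheory GRing.Theory Num.Theory.

Local Open Scope ring_scope.

(** For an edge with end degrees [x] and [y] and an extremal degree [m] (the
    maximum if [a > 0], the minimum if [a < 0]), both [x `^ a] and [y `^ a] are
    at most [m `^ a], while the term [2 sqrt (x y) / (x + y)] of the
    geometric-arithmetic index is at most [1] by the AM-GM inequality. Hence
    [1/2 m^(-a) 2 sqrt (x y) / (x + y) <= 1/2 m^(-a) <= 1 / (x^a + y^a)]
    ([edge_leif]), and since [t |-> t `^ a] is injective on positive reals,
    equality holds exactly if [x = y = m]. Summing over the edges gives the
    bound; it is attained iff both ends of every edge have degree [m], which in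
    the absence of isolated vertices means that all degrees are [m]
    ([ISD_leif]). An extremal degree of a nonempty graph is the common degree as
    soon as the graph is regular, so this is regularity. *)

Section EdgeTerm.
Set Implicit Arguments.
Unset Strict Implicit.
Variable R : realType.
Implicit Types a x y p q m : R.

Lemma leif_GA_term x y : 0 < x -> 0 < y ->
  2 * Num.sqrt (x * y) / (x + y) <= 1 ?= iff (x == y).
Proof.
move=> x0 y0; have xy0 : 0 < x + y by rewrite addr_gt0.
rewrite -(mono_leif (ler_pM2r xy0)) mul1r divfK ?lt0r_neq0 //.
have sx := sqr_sqrtr (ltW x0); have sy := sqr_sqrtr (ltW y0).
have D : x + y - 2 * Num.sqrt (x * y) = (Num.sqrt x - Num.sqrt y) ^+ 2.
  by rewrite sqrtrM ?ltW // sqrrB sx sy; ring.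
apply/leifP; case: (eqVneq x y) => [->|neq].
  by rewrite -expr2 sqrtr_sqr gtr0_norm //; apply/eqP; ring.
rewrite -subr_gt0 D exprn_even_gt0 //= subr_eq0.
by apply: contra neq => /eqP e; rewrite -sx -sy e.
Qed.

Lemma leif_inv_sum p q m : 0 < p -> 0 < q -> p <= m -> q <= m ->
  1 / 2 * m^-1 <= 1 / (p + q) ?= iff (p == m) && (q == m).
Proof.
move=> p0 q0 pm qm; have m0 := lt_le_trans p0 pm.
have pq := leifD (leif_eq pm) (leif_eq qm).
have -> : 1 / 2 * m^-1 = (m + m)^-1.
  by field; rewrite !lt0r_neq0 ?addr_gt0.
rewrite div1r; split.
  by rewrite lef_pV2 ?posrE ?addr_gt0 // pq.
by rewrite (inj_eq invr_inj) eq_sym pq.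
Qed.

Lemma powR_inj_pos a x y : a != 0 -> 0 < x -> 0 < y ->
  x `^ a = y `^ a -> x = y.
Proof.
move=> a0 x0 y0 e.
by rewrite -(powRr1 (ltW x0)) -(powRr1 (ltW y0)) -(mulfV a0) !powRrM e.
Qed.

(** The condition [x = y = m] absorbs the equality case of AM-GM: once
    [x `^ a] and [y `^ a] both equal [m `^ a], injectivity forces [x = y]. *)
Lemma edge_leif a x y m : a != 0 -> 0 < x -> 0 < y -> 0 < m ->
  x `^ a <= m `^ a -> y `^ a <= m `^ a ->
  1 / 2 * m `^ (- a) * (2 * Num.sqrt (x * y) / (x + y))
    <= 1 / (x `^ a + y `^ a) ?= iff (x == m) && (y == m).
Proof.
move=> a0 x0 y0 m0 xm ym.
have c0 : 0 < 1 / 2 * m `^ (- a) by rewrite mulr_gt0 ?powR_gt0 ?divr_gt0.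
have GA1 := leif_GA_term x0 y0.
rewrite -(mono_leif (ler_pM2l c0)) mulr1 in GA1.
have inv := leif_inv_sum (powR_gt0 a x0) (powR_gt0 a y0) xm ym.
rewrite -powRN in inv.
rewrite (_ : _ && _ = (x == y) && ((x `^ a == m `^ a) && (y `^ a == m `^ a))).
  exact: leif_trans GA1 inv.
apply/andP/and3P => [[/eqP-> /eqP->] //|[_ /eqP ex /eqP ey]].
by split; apply/eqP; apply: (powR_inj_pos a0).
Qed.

End EdgeTerm.

Section Graph.
Set Implicit Arguments.
Unset Strict Implicit.
Variable G : sgraph.

(** Sums over all edges are compared termwise, but the terms only make sense for
    the two-element sets given by adjacent vertices. *)
Lemma edgesP (E : {set G}) :
  reflect (exists u v, adj u v /\ E = [set u; v]) (E \in edges G).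
Proof.
rewrite inE; apply: (iffP existsP) => [[u /existsP[v /andP[uv /eqP->]]]|].
  by exists u, v.
by move=> [u [v [uv ->]]]; exists u; apply/existsP; exists v; rewrite uv eqxx.
Qed.

(** Every vertex is an end of some edge, so a property of all ends of edges is a
    property of all vertices. *)
Lemma forall_edgesP (P : pred G) : no_isolated G ->
  reflect (forall u, P u) [forall (E | E \in edges G), [forall w in E, P w]].
Proof.
move=> noiso; apply: (iffP forall_inP) => [H u|H E _]; last first.
  by apply/forall_inP => w _.
have /card_gt0P[v] := noiso u; rewrite inE => uv.
have /H/forall_inP -> // : [set u; v] \in edges G by apply/edgesP; exists u, v.
by rewrite !inE eqxx.
Qed.

(** The hypothesis on powers is the common form of [deg u <= m] for [a > 0] and
    [m <= deg u] for [a < 0]. *)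
Lemma ISD_leif (R : realType) (a : R) (m : nat) :
    no_isolated G -> a != 0 -> (0 < m)%N ->
    (forall u : G, (deg u)%:R `^ a <= m%:R `^ a) ->
  1 / 2 * m%:R `^ (- a) * GA R G <= ISD G a
    ?= iff [forall (E | E \in edges G), [forall w in E, deg w == m]].
Proof.
move=> noiso a0 m0 degm; rewrite /GA /ISD mulr_sumr.
apply: leif_sum => E /edgesP[u [v [uv ->]]].
rewrite !big_edge //=.
rewrite (_ : [forall w in _, _] = ((deg u)%:R == m%:R :> R) &&
                                    ((deg v)%:R == m%:R :> R)).
  by apply: edge_leif; rewrite ?ltr0n ?noiso.
rewrite !eqr_nat; apply/forall_inP/andP => [H|[du dv] w].
  by split; apply: H; rewrite !inE eqxx ?orbT.
by rewrite !inE => /orP[] /eqP->.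
Qed.

(** The bound [m] of [ISD_leif] is taken to be an attained degree [deg u0]:
    only then is a graph regular exactly if all degrees are [m]. *)
Lemma ISD_bound (R : realType) (a : R) (u0 : G) :
    no_isolated G -> a != 0 ->
    (forall u : G, (deg u)%:R `^ a <= (deg u0)%:R `^ a) ->
  ISD G a >= 1 / 2 * (deg u0)%:R `^ (- a) * GA R G /\
  (ISD G a = 1 / 2 * (deg u0)%:R `^ (- a) * GA R G <-> regular G).
Proof.
move=> noiso a0 degm.
have [le eq] := ISD_leif noiso a0 (noiso u0) degm.
split=> //; split=> [/esym/eqP|reg].
  rewrite eq => /(forall_edgesP _ noiso) H u v.
  by rewrite (eqP (H u)) (eqP (H v)).
by apply/esym/eqP; rewrite eq; apply/(forall_edgesP _ noiso) => u; apply/eqP.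
Qed.

Lemma max_deg_attained : (0 < #|G|)%N -> exists u : G, max_deg G = deg u.
Proof.
by move=> G0; have [u] := @bigop.eq_bigmax (vertex G) (@deg G) G0; exists u.
Qed.

Lemma min_deg_le (u : G) : (min_deg G <= deg u)%N.
Proof. by rewrite /min_deg -minEnat -leEnat bigmin_le. Qed.

Lemma min_deg_attained : (0 < #|G|)%N -> exists u : G, min_deg G = deg u.
Proof.
move=> /card_gt0P[u0 _]; rewrite /min_deg -minEnat.
rewrite (bigmin_eq_arg _ u0) // => [|u _]; last exact: max_card.
by eexists.
Qed.

End Graph.

Theorem theorem4 (R : realType) (G : sgraph) (a : R)
    (G_nonempty : (0 < #|G|)%N) (G_no_isolated : no_isolated G) :
  (0 < a ->
     ISD G a >= 1 / 2 * (max_deg G)%:R `^ (- a) * GA R G /\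
     (ISD G a = 1 / 2 * (max_deg G)%:R `^ (- a) * GA R G <-> regular G)) /\
  (a < 0 ->
     ISD G a >= 1 / 2 * (min_deg G)%:R `^ (- a) * GA R G /\
     (ISD G a = 1 / 2 * (min_deg G)%:R `^ (- a) * GA R G <-> regular G)).
Proof.
split=> a0.
  have [u0 du0] := max_deg_attained G_nonempty.
  rewrite du0; apply: ISD_bound => [//||u]; first by rewrite gt_eqF.
  by rewrite ge0_ler_powR ?(ltW a0) ?nnegrE ?ler0n // ler_nat -du0 leq_bigmax.
have [u0 du0] := min_deg_attained G_nonempty.
rewrite du0; apply: ISD_bound => [//||u]; first by rewrite lt_eqF.
(* [t |-> t `^ a] is the reciprocal of the increasing [t |-> t `^ (- a)]. *)
have pos (v : G) : 0 < (deg v)%:R `^ (- a) :> R.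
  by rewrite powR_gt0 ?ltr0n ?G_no_isolated.
rewrite -[a]opprK powRN (powRN (deg u0)%:R) lef_pV2 ?posrE //.
by rewrite ge0_ler_powR ?oppr_ge0 ?(ltW a0) ?nnegrE ?ler0n //
  ler_nat -du0 min_deg_le.
Qed.
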